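(* Let $D_1,D_2,D_3,D_4$ be tree degree sequences on a common set of $n$ vertices without common leaves. Then they have edge disjoint tree realizations, i.e. there exist pairwise edge-disjoint trees $T_1,\dots,T_4$ on these $n$ vertices such that each $T_i$ has degree sequence $D_i$.
   Context: A tree degree sequence on $n$ vertices is a list of positive integers $d_1,\dots,d_n$ with $\sum_i d_i=2n-2$. $d_v^{(i)}$ denotes the entry of vertex $v$ in $D_i$. The sequences have no common leaves if for every vertex $v$ and index $i$, $d_v^{(i)}=1$ implies $d_v^{(j)}>1$ for all $j\ne i$. *)

(* Defs.v *)
From mathcomp Require Import all_boot.

Set Implicit Arguments.
Unset Strict Implicit.
Unset Printing Implicit Defensive.

(* The two conditions give n >= 2. The sum condition is written additively
   because 2 * n - 2 is truncated to 0 at n = 0. *)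
Definition tree_degree_sequence (n : nat) (d : 'I_n -> nat) : Prop :=
  (forall v, 0 < d v) /\ (\sum_(v < n) d v) + 2 = 2 * n.

Definition no_common_leaves (k n : nat) (D : 'I_k -> 'I_n -> nat) : Prop :=
  forall (v : 'I_n) (i : 'I_k), D i v = 1 ->
  forall j : 'I_k, j != i -> 1 < D j v.

Definition simple_graph (V : finType) (e : rel V) : Prop :=
  symmetric e /\ irreflexive e.

Definition connected_graph (V : finType) (e : rel V) : Prop :=
  0 < #|V| /\ forall x y : V, connect e x y.

(* For a symmetric relation every edge x -- y makes [:: x; y] a duplicate-free
   e-cycle, hence the bound on the length. *)
Definition acyclic_graph (V : finType) (e : rel V) : Prop :=
  forall c : seq V, ucycle e c -> size c <= 2.

Definition is_tree (V : finType) (e : rel V) : Prop :=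
  [/\ simple_graph e, connected_graph e & acyclic_graph e].

Definition degree (V : finType) (e : rel V) (v : V) : nat := #|[set u | e v u]|.

Definition edge_disjoint (V : finType) (e f : rel V) : Prop :=
  forall u v : V, ~~ (e u v && f u v).

(* Main.v *)
(* Induction on the number of vertices.  Call a vertex tight if it is a leaf of
   one tree and has degree 2 in the three others.  A tight leaf v of tree i can
   be deleted by lowering the degree of a suitable w in tree i; conversely v is
   reinserted as a leaf attached to w in tree i, while subdividing in each other
   tree one edge.  The trees stay edge-disjoint when the three subdivided edges
   form a matching that avoids w, which we call a rainbow.

   With at least 10 vertices every realization contains every required rainbow:
   let C be the one of the three trees with the fewest leaves, and choose edges
   of the other two whose endpoints together with w contain two leaves of C.  If
   these five vertices covered all edges of C, counting degrees would leave C
   with too many other leaves.  The induction starts from the zigzag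
   decomposition of K_8 into Hamiltonian paths; the rainbows on 8 vertices, and
   on 9 vertices after one insertion, are found by computation. *)

Require Import Defs.
From mathcomp Require Import all_boot zify.

Set Implicit Arguments.
Unset Strict Implicit.
Unset Printing Implicit Defensive.

(** * Trees on a vertex subset: attaching a leaf, subdividing an edge, paths *)

Section TreesOnSubsets.

Variable V : finType.
Implicit Types (e : rel V) (S U : {set V}) (v w x y : V).

Definition link (p : V * V) : rel V :=
  fun x y => (x == p.1) && (y == p.2) || (x == p.2) && (y == p.1).

Definition add_leaf e w v : rel V := fun x y => e x y || link (w, v) x y.

Definition subdivide e (p : V * V) v : rel V := fun x y =>
  [|| e x y && ~~ link p x y, link (p.1, v) x y | link (p.2, v) x y].

(** The vertex type stays fixed while the induction shrinks [S]; by symmetry both ends of every edge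
    lie in [S], so vertices outside are isolated. *)
Definition tree_on S e : Prop :=
  [/\ symmetric e, irreflexive e, forall x y, e x y -> x \in S,
      {in S &, forall x y, connect e x y} & acyclic_graph e].

Lemma linkC p : symmetric (link p).
Proof. by move=> x y; rewrite /link; do 4!case: (_ == _). Qed.

Lemma link_irr p : p.1 != p.2 -> irreflexive (link p).
Proof.
move=> np x; rewrite /link [X in _ || X]andbC orbb; apply/negbTE.
by apply: contraNN np => /andP[/eqP<- /eqP<-].
Qed.

Lemma add_leaf_sym e w v : symmetric e -> symmetric (add_leaf e w v).
Proof. by move=> se x y; rewrite /add_leaf se linkC. Qed.

Lemma subdivide_sym e p v : symmetric e -> symmetric (subdivide e p v).
Proof. by move=> se x y; rewrite /subdivide se !(linkC _ x y). Qed.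

(** A cycle avoiding [v] is a cycle of [e]. On a cycle through [v] both neighbours of [v] must be
    [w], so its length is at most 2. *)
Lemma tree_add_leaf S e w v :
  tree_on S e -> w \in S -> v \notin S -> tree_on (v |: S) (add_leaf e w v).
Proof.
move=> [se ie Se ce ae] wS vS.
have vw : v != w by apply: contraNneq vS => ->.
have Nv y : e v y = false by apply: contraNF vS => /Se.
have sf := add_leaf_sym w v se.
have cf x : x \in v |: S -> connect (add_leaf e w v) x w.
  rewrite !inE => /orP[/eqP->|xS].
    by apply: connect1; rewrite /add_leaf /link /= !eqxx !orbT.
  by apply: connect_sub (ce _ _ xS wS) => a b ab; apply: connect1; rewrite /add_leaf ab.
split=> //.
- by move=> x; rewrite /add_leaf ie link_irr //= eq_sym.
- move=> x y /orP[/Se xS|]; first by rewrite inE xS orbT.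
  by case/orP=> /andP[/eqP-> _]; rewrite !inE ?wS ?eqxx ?orbT.
- move=> x y /cf xw /cf; rewrite (sym_connect_sym sf); exact: connect_trans.
move=> c; have [vc|vc] := boolP (v \in c); last first.
  case/andP=> cc uc; apply: ae; rewrite /ucycle uc andbT.
  apply: sub_in_cycle cc; last by apply/allP => x xc; exact: xc.
  move=> x y xc yc /orP[//|] /orP[] /andP[/eqP Ex /eqP Ey]; subst.
    by rewrite yc in vc.
  by rewrite xc in vc.
have [i p Ep] := rot_to vc.
rewrite -(rot_ucycle i) -(size_rot i) {}Ep => /andP[/= cc uc].
have Nvf y : add_leaf e w v v y -> y = w.
  rewrite /add_leaf Nv /link /= eqxx (negPf vw) /=; exact: eqP.
case: p cc uc => [|x p] //=; rewrite rcons_path => /andP[/Nvf xw].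
rewrite xw => /andP[_]; rewrite sf => /Nvf.
case/lastP: p => [|p z] //; rewrite last_rcons => -> /andP[_].
by rewrite mem_rcons inE eqxx.
Qed.

(** A long cycle through [v] becomes a cycle of [e] when its passage through [v] is replaced by the
    subdivided edge. *)
Lemma tree_subdivide S e p v :
  tree_on S e -> e p.1 p.2 -> v \notin S -> tree_on (v |: S) (subdivide e p v).
Proof.
case: p => a b /= [se ie Se ce ae] eab vS.
have aS := Se _ _ eab.
have bS : b \in S by apply: (Se _ a); rewrite se.
have va : v != a by apply: contraNneq vS => ->.
have vb : v != b by apply: contraNneq vS => ->.
have ab : a != b by apply: contraTneq eab => ->; rewrite ie.
have Nv y : e v y = false by apply: contraNF vS => /Se.
set f := subdivide e (a, b) v.
have sf : symmetric f := subdivide_sym (a, b) v se.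
have fva : f v a by rewrite /f /subdivide /link /= !eqxx !orbT.
have fvb : f v b by rewrite /f /subdivide /link /= !eqxx !orbT.
have cf x : x \in v |: S -> connect f x a.
  rewrite !inE => /orP[/eqP->|xS]; first exact: connect1.
  apply: connect_sub (ce _ _ xS aS) => {xS}x y xy.
  have [L|L] := boolP (link (a, b) x y); last first.
    by apply: connect1; rewrite /f /subdivide xy L.
  case/orP: L => /= /andP[/eqP-> /eqP->]; apply: (@connect_trans _ _ v);
    by apply: connect1 => //; rewrite sf.
split=> //.
- move=> x; rewrite /f /subdivide ie /=.
  by rewrite !link_irr //= eq_sym.
- move=> x y /or3P[/andP[/Se xS _]||]; first by rewrite inE xS orbT.
    by case/orP=> /andP[/eqP-> _]; rewrite !inE ?aS ?eqxx ?orbT.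
  by case/orP=> /andP[/eqP-> _]; rewrite !inE ?bS ?eqxx ?orbT.
- move=> x y /cf xw /cf; rewrite (sym_connect_sym sf); exact: connect_trans.
have fe x y : x != v -> y != v -> f x y -> e x y && ~~ link (a, b) x y.
  move=> xv yv /or3P[//||] /orP[] /andP[/= E1 E2].
  - by rewrite E2 in yv.
  - by rewrite E1 in xv.
  - by rewrite E2 in yv.
  - by rewrite E1 in xv.
move=> c; have [vc|vc] := boolP (v \in c); last first.
  case/andP=> cc uc; apply: ae; rewrite /ucycle uc andbT.
  apply: (@sub_in_cycle _ [pred x | x != v] f e) cc.
    by move=> x y xv yv /(fe _ _ xv yv) /andP[].
  by apply/allP => x xc; apply: contraNneq vc => <-.
have [i p Ep] := rot_to vc.
rewrite -(rot_ucycle i) -(size_rot i) {}Ep => /andP[/= cc uc].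
have Nvf y : f v y -> y = a \/ y = b.
  rewrite /f /subdivide Nv /link /= eqxx (negPf va) (negPf vb) /=.
  by case/orP=> /eqP; [left|right].
case: p cc uc => [|x p] //=; rewrite rcons_path => /andP[/Nvf xab].
case/andP=> pp; rewrite sf => /Nvf yab /and3P[].
rewrite inE negb_or => /andP[vx vp] xp up.
case: (posnP (size p)) => [->//|p0]; exfalso.
(* The cycle is [v :: x :: p]. The two neighbours of [v] on it are distinct, hence they are [a] and
   [b]. *)
have xy : x != last x p.
  apply: contraNneq xp => ->; case: p p0 {pp vp up yab} => //= z p _; exact: mem_last.
have Lxy : link (a, b) (last x p) x.
  by move: (last x p) yab xy => y [] ->; case: xab => ->; rewrite /link !eqxx ?orbT.
have pe : path e x p && path (fun x y => ~~ link (a, b) x y) x p.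
  elim: p x {xab p0 yab xp up xy Lxy} vx vp pp => //= z p IH x vx.
  rewrite inE negb_or => /andP[vz vp] /andP[fxz /(IH _ vz vp)/andP[-> ->]].
  by rewrite !andbT fe // eq_sym.
case/andP: pe => pe pl.
have ce' : ucycle e (x :: p).
  rewrite /ucycle /= rcons_path pe xp up !andbT.
  by case/orP: Lxy => /= /andP[/eqP-> /eqP->] //; rewrite se.
(* Acyclicity of [e] leaves only [p = [:: z]]; then the step from [x] to [z] is the edge [a]--[b],
   which the path avoids. *)
move: (ae _ ce'); clear - p0 pl Lxy; case: p p0 pl Lxy => [|z []] //= _.
by rewrite andbT linkC => /negP.
Qed.

Lemma degree_add_leaf S e w v x :
  tree_on S e -> w \in S -> v \notin S -> x \in S ->
  degree (add_leaf e w v) x = degree e x + (x == w).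
Proof.
move=> [se _ Se _ _] wS vS xS.
have xv : x == v = false by apply/negbTE; apply: contraNneq vS => <-.
have exv : e x v = false by rewrite se; apply: contraNF vS => /Se.
rewrite /degree /add_leaf /link /=; have [->|xw] := eqVneq x w; last first.
  by rewrite addn0; apply: eq_card => u; rewrite !inE xv /= !orbF.
rewrite addn1 (_ : [set u | _] = v |: [set u | e w u]); last first.
  apply/setP => u; rewrite !inE /= orbC; case: (u == v) => //=.
  by rewrite [w == v](contraNF _ vS) // => /eqP <-.
rewrite cardsU1 inE; have -> : e w v = false by rewrite se; apply: contraNF vS => /Se.
by [].
Qed.

Lemma degree_add_leaf_new S e w v :
  tree_on S e -> w \in S -> v \notin S -> degree (add_leaf e w v) v = 1.
Proof.
move=> [se _ Se _ _] wS vS.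
rewrite /degree -(cards1 w); apply: eq_card => u.
rewrite !inE /add_leaf /link /= eqxx /= [e v u](contraNF _ vS) => [|/Se//].
by rewrite [v == w](contraNF _ vS) => // /eqP->.
Qed.

Lemma degree_subdivide S e p v x :
  tree_on S e -> e p.1 p.2 -> v \notin S -> x \in S ->
  degree (subdivide e p v) x = degree e x.
Proof.
case: p => a b /= [se ie Se _ _] eab vS xS.
have xv : x == v = false by apply/negbTE; apply: contraNneq vS => <-.
have exv y : e y v = false by rewrite se; apply: contraNF vS => /Se.
have ab : a == b = false by apply: contraTF eab => /eqP->; rewrite ie.
rewrite /degree /subdivide /link /=.
(* An end of the subdivided edge trades its neighbour [d] for [v]. *)
have swap c d : e c d -> x = c -> c == d = false ->
    #|[set u | e c u && (u != d) || (u == v)]| = #|[set u | e c u]|.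
  move=> ecd E cd; subst c; rewrite (_ : [set u | _] = v |: ([set u | e x u] :\ d)); last first.
    by apply/setP => u; rewrite !inE orbC andbC.
  by rewrite cardsU1 !inE exv andbF [in RHS](cardsD1 d) inE ecd.
have [xa|xa] := eqVneq x a.
  rewrite [in RHS]xa -(swap _ _ eab xa ab); congr #|pred_of_set _|; apply/setP => u.
  by rewrite !inE xv xa ab ?eqxx /= !orbF.
have [xb|xb] := eqVneq x b.
  have eba : e b a by rewrite se.
  rewrite [in RHS]xb -(swap b a eba xb) ?[b == a]eq_sym //; congr #|pred_of_set _|.
  by apply/setP => u; rewrite !inE xv xb /= !orbF.
by congr #|pred_of_set _|; apply/setP => u; rewrite !inE xv /= ?andbT !orbF.
Qed.

Lemma degree_subdivide_new S e p v :
  tree_on S e -> e p.1 p.2 -> v \notin S -> degree (subdivide e p v) v = 2.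
Proof.
case: p => a b /= [se ie Se _ _] eab vS.
have ab : a != b by apply: contraTneq eab => ->; rewrite ie.
have bS : b \in S by apply: (Se _ a); rewrite se.
transitivity #|[set a; b]|; last by rewrite cards2 ab.
rewrite /degree; apply: eq_card => u.
rewrite !inE /subdivide /link /= eqxx [e v u](contraNF _ vS) => [|/Se//] /=.
rewrite [v == a](contraNF _ vS) => [|/eqP->]; last exact: Se eab.
by rewrite [v == b](contraNF _ vS) => [|/eqP->].
Qed.

Fixpoint edge_rel (E : seq (V * V)) : rel V :=
  if E is p :: E' then add_leaf (edge_rel E') p.1 p.2 else fun _ _ => false.

Lemma edge_relE E x y : edge_rel E x y = ((x, y) \in E) || ((y, x) \in E).
Proof.
elim: E => //= -[a b] E IH; rewrite /add_leaf IH /link !inE !xpair_eqE /=.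
by rewrite [(y == a) && _]andbC orbCA -!orbA orbC -!orbA; do !bool_congr.
Qed.

(** The path grows from its last vertex: the pair [(y, x)] attaches [x] as a leaf to its successor
    [y]. *)
Lemma tree_path x s :
  uniq (x :: s) -> tree_on [set z in x :: s] (edge_rel (zip s (x :: s))).
Proof.
elim: s x => [|y s IH] x.
  move=> _; split=> //= [u w|c].
    by rewrite !inE => /eqP-> /eqP->.
  by case: c => [|z [|t c]] //=.
rewrite cons_uniq => /andP[xs /IH tr] /=.
have -> : [set z in x :: y :: s] = x |: [set z in y :: s].
  by apply/setP => z; rewrite !inE.
by apply: tree_add_leaf => //; rewrite !inE ?eqxx // -in_cons.
Qed.

Lemma degree_path x s z : uniq (x :: s) -> z \in x :: s ->
  degree (edge_rel (zip s (x :: s))) z = (z != x) + (z != last x s).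
Proof.
elim: s x => [|y s IH] x.
  rewrite inE => _ /eqP->; rewrite eqxx /degree /=.
  by apply/eqP; rewrite cards_eq0; apply/eqP/setP => u; rewrite !inE.
rewrite cons_uniq => /andP[xs us] zs; have tr := tree_path us.
have [->|zx] := eqVneq z x.
  rewrite /= (degree_add_leaf_new tr) ?inE ?eqxx //.
  by case: eqVneq => // E; move: xs; rewrite E mem_last.
have zys : z \in y :: s by move: zs; rewrite inE (negPf zx).
rewrite /= (degree_add_leaf tr) ?inE ?eqxx -?in_cons // IH //.
by case: (z == y); case: (z != _).
Qed.

End TreesOnSubsets.

(** * Reinserting a vertex along a rainbow, and edges avoiding a small set *)

Section Realizations.

Variable V : finType.
Implicit Types (S U : {set V}) (v w x y : V) (i j : 'I_4).
Implicit Types (D : 'I_4 -> V -> nat) (T : 'I_4 -> rel V) (f : 'I_4 -> V * V).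

Definition valid S D : Prop :=
  [/\ forall j v, v \in S -> 0 < D j v,
      forall j, (\sum_(v in S) D j v) + 2 = 2 * #|S|
    & forall v i j, v \in S -> D i v = 1 -> j != i -> 1 < D j v].

Definition realizes S D T : Prop :=
  [/\ forall j, tree_on S (T j), forall j v, v \in S -> degree (T j) v = D j v
    & forall i j, i != j -> edge_disjoint (T i) (T j)].

Definition ends (p : V * V) : seq V := [:: p.1; p.2].

Definition rainbow T i w f : Prop :=
  (forall j, j != i -> T j (f j).1 (f j).2 /\ w \notin ends (f j)) /\
  (forall j k x, j != i -> k != i -> x \in ends (f j) -> x \in ends (f k) -> j = k).

Definition insert T i w f v : 'I_4 -> rel V := fun j =>
  if j == i then add_leaf (T j) w v else subdivide (T j) (f j) v.

Lemma realizes_insert S D D' T i w f v :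
  realizes S D' T -> w \in S -> v \notin S -> rainbow T i w f ->
  (forall j x, x \in S -> D j x = D' j x + ((j == i) && (x == w))) ->
  (forall j, D j v = if j == i then 1 else 2) ->
  realizes (v |: S) D (insert T i w f v).
Proof.
move=> [tT dT disT] wS vS [fT fdis] DS Dv.
have TS j x y : T j x y -> x \in S by case: (tT j) => _ _ + _ _; exact.
have TS2 j x y : T j x y -> y \in S by case: (tT j) => se _ _ _ _; rewrite se; exact: TS.
split=> [j|j x|j k jk x y].
- by rewrite /insert; case: (eqVneq j i) => [->|/fT[e _]];
    [apply: tree_add_leaf | apply: tree_subdivide].
- rewrite /insert; case/setU1P => [->|xS]; have [E|/[dup] ji /fT[e _]] := eqVneq j i.
  + by rewrite Dv E eqxx (degree_add_leaf_new (tT i)).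
  + by rewrite Dv (negPf ji) (degree_subdivide_new (tT j)).
  + by rewrite DS // E eqxx (degree_add_leaf (tT i)) // dT.
  + by rewrite DS // (negPf ji) (degree_subdivide (tT j)) // dT // addn0.
(* [N l] lists the neighbours of [v] in the new tree [l]. The rainbow condition makes these lists
   disjoint, so no edge at [v] is shared; the edges away from [v] are old ones. *)
pose N l := if l == i then [:: w] else ends (f l).
have insE l a b : insert T i w f v l a b ->
    [\/ T l a b, a = v /\ b \in N l | b = v /\ a \in N l].
  rewrite /insert /N; case: eqVneq => [->|_].
    case/orP=> [|/orP[] /andP[/eqP-> /eqP->]]; first by constructor 1.
      by constructor 3; rewrite inE.
    by constructor 2; rewrite inE.
  case/or3P=> [/andP[]||]; first by constructor 1.
    by case/orP=> /andP[/eqP-> /eqP->]; [constructor 3 | constructor 2];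
      rewrite !inE eqxx.
  by case/orP=> /andP[/eqP-> /eqP->]; [constructor 3 | constructor 2];
      rewrite !inE eqxx orbT.
have NS l a : a \in N l -> a \in S.
  rewrite /N; case: eqVneq => [_|/fT[e _]]; first by rewrite inE => /eqP->.
  by rewrite !inE => /orP[] /eqP->; [exact: TS e | exact: TS2 e].
have Ndis a : a \in N j -> a \in N k -> False.
  rewrite /N; have [ji|ji] := eqVneq j i; have [ki|ki] := eqVneq k i.
  - by rewrite ji ki eqxx in jk.
  - by rewrite inE => /eqP->; apply/negP; case: (fT _ ki).
  - by move=> aj; rewrite inE => /eqP aw; rewrite aw in aj; case: (fT _ ji) => _; rewrite aj.
  - by move=> aj ak; rewrite (fdis j k a) // eqxx in jk.
have vN l : v \in N l -> False by move/NS; apply/negP.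
apply/negP => /andP[/insE + /insE].
case=> [Tj|[E aN]|[E aN]] [Tk|[E' aN']|[E' aN']]; subst.
- by move/negP: (disT _ _ jk x y); rewrite Tj Tk.
- by rewrite (TS _ _ _ Tj) in vS.
- by rewrite (TS2 _ _ _ Tj) in vS.
- by rewrite (TS _ _ _ Tk) in vS.
- exact: Ndis aN aN'.
- exact: vN aN.
- by rewrite (TS2 _ _ _ Tk) in vS.
- exact: vN aN.
- exact: Ndis aN aN'.
Qed.

(* A set U covering all edges carries at least half of the degree sum. *)
Lemma exists_uncovered_edge S U d e :
  symmetric e -> (forall x y, e x y -> x \in S) ->
  (forall x, x \in S -> degree e x = d x) -> (forall x, x \in S -> 0 < d x) ->
  (\sum_(x in S) d x) + 2 = 2 * #|S| -> U \subset S ->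
  2 * #|U| + #|[set x in S :\: U | d x == 1]| <= #|S| ->
  exists p : V * V, [/\ e p.1 p.2, p.1 \notin U & p.2 \notin U].
Proof.
move=> se Se de d0 sd US small.
have [/existsP[p /and3P[]]|/existsPn none] :=
  boolP [exists p : V * V, [&& e p.1 p.2, p.1 \notin U & p.2 \notin U]].
  by exists p.
exfalso; have cover x y : e x y -> x \notin U -> y \in U.
  by move=> exy xU; move: (none (x, y)); rewrite /= exy xU negbK.
(* Only the leaves outside [U] fall short of degree 2, each by one. *)
have low : 2 * #|S :\: U| <= (\sum_(x in S :\: U) d x) + #|[set x in S :\: U | d x == 1]|.
  rewrite -sum1_card big_distrr /= -sum1dep_card big_mkcondr -big_split /=.
  apply: leq_sum => x; rewrite inE => /andP[_ xS].
  by have := d0 x xS; case: eqP; lia.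
have sdeg x : degree e x = \sum_y (e x y : nat).
  by rewrite /degree -sum1dep_card big_mkcond.
have split_sum : \sum_(x in S) d x = \sum_(x in U) d x + \sum_(x in S :\: U) d x.
  by rewrite (big_setID U) /= (setIidPr US).
(* Double counting: every edge at a vertex outside [U] has its other end in [U]. *)
have up : \sum_(x in S :\: U) d x <= \sum_(x in U) d x.
  rewrite (eq_bigr (fun x => \sum_(y in U) (e x y : nat))); last first.
    move=> x; rewrite inE => /andP[xU xS]; rewrite -de // sdeg.
    rewrite (bigID [pred y in U]) /= addnC big1 // => y yU.
    by case E: (e x y) => //; rewrite (cover _ _ E xU) in yU.
  rewrite exchange_big /=; apply: leq_sum => y yU.
  rewrite -de ?(subsetP US) // sdeg big_mkcond; apply: leq_sum => x _.
  by rewrite se; case: ifP.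
have : #|S| = #|U| + #|S :\: U| by rewrite -(cardsID U S) (setIidPr US).
(* The degrees outside [U] sum to at most [#|S| - 1], so [low] makes twice [#|U|] plus the number of
   leaves outside at least [#|S| + 1]. *)
lia.
Qed.

(** * Two disjoint edges that absorb two leaves of a third tree *)

Lemma distinct_choice (P Q : {set V}) :
  0 < #|P| -> 0 < #|Q| -> 2 < #|P| + #|Q| ->
  exists p q, [/\ p \in P, q \in Q & p != q].
Proof.
have aux (P' Q' : {set V}) : 0 < #|Q'| -> 1 < #|P'| ->
    exists p q, [/\ p \in P', q \in Q' & p != q].
  move=> /card_gt0P[q qQ]; rewrite (cardsD1 q) => P2.
  have /card_gt0P[p] : 0 < #|P' :\ q| by move: P2; case: (q \in P'); lia.
  by rewrite !inE => /andP[pq pP]; exists p, q.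
move=> P0 Q0 PQ; have [P1|P1] := leqP #|P| 1; last exact: aux.
have [|q [p [qQ pP qp]]] := aux Q P P0; first by lia.
by exists p, q; rewrite eq_sym.
Qed.

(** [L] will be the leaf set of a third tree. Three situations arise: [w] is in [L] and an edge of
    [A] at another vertex of [L] suffices; two vertices of [L] are joined in [A] or [B]; or an edge
    of [A] is taken at one of them and an edge of [B] at the other. *)
Lemma disjoint_edges_covering_leaves S (L : {set V}) (A B : rel V) w :
  tree_on S A -> tree_on S B -> edge_disjoint A B ->
  {in L, forall u, 1 < degree A u} -> {in L, forall u, 1 < degree B u} ->
  L \subset S -> w \in S -> 1 < #|L| ->
  (forall U, U \subset S -> #|U| <= 3 ->
     exists p : V * V, [/\ A p.1 p.2, p.1 \notin U & p.2 \notin U]) ->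
  (forall U, U \subset S -> #|U| <= 3 ->
     exists p : V * V, [/\ B p.1 p.2, p.1 \notin U & p.2 \notin U]) ->
  exists p q : V * V,
    [/\ A p.1 p.2, B q.1 q.2, uniq (w :: ends p ++ ends q)
      & 1 < #|L :&: [set x in w :: ends p ++ ends q]|].
Proof.
move=> tA tB disAB dA dB LS wS L2 hA hB.
have [sA iA AS _ _] := tA; have [sB iB BS _ _] := tB.
have two u u' (s : seq V) : u \in L -> u' \in L -> u != u' -> u \in s -> u' \in s ->
    1 < #|L :&: [set x in s]|.
  move=> uL u'L uu' us u's; rewrite -[2](_ : #|[set u; u']| = 2); last by rewrite cards2 uu'.
  by apply/subset_leq_card/subsetP => x; rewrite !inE => /orP[] /eqP->; apply/andP.
have card3 x y z : #|[set x; y; z]| <= 3.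
  by rewrite -setUA cardsU1 cards2; case: (_ \notin _); case: (_ == _).
have sub3 x y z : x \in S -> y \in S -> z \in S -> [set x; y; z] \subset S.
  by move=> xS yS zS; apply/subsetP => t; rewrite !inE => /orP[/orP[]|] /eqP->.
have LSS x : x \in L -> x \in S by apply/subsetP.
have AN x y : A x y -> x != y by apply: contraTneq => ->; rewrite iA.
have BN x y : B x y -> x != y by apply: contraTneq => ->; rewrite iB.
have [u uL uw] : exists2 u, u \in L & u != w.
  have /card_gt0P[u] : 0 < #|L :\ w| by move: L2; rewrite (cardsD1 w); case: (w \in L); lia.
  by rewrite !inE => /andP[uw uL]; exists u.
have [wL|wL] := boolP (w \in L).
  have /card_gt0P[p] : 0 < #|[set y | A u y] :\ w|.
    by have := dA _ uL; rewrite /degree (cardsD1 w); case: (w \in _); lia.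
  rewrite !inE => /andP[pw Aup].
  have pS : p \in S by apply: (AS _ u); rewrite sA.
  have [|//|q [Bq]] := hB [set w; u; p]; first by apply: sub3 => //; exact: LSS.
  rewrite !inE !negb_or => /andP[/andP[q1w q1u] q1p] /andP[/andP[q2w q2u] q2p].
  exists (u, p), q; split=> //; last by apply: (two u w); rewrite ?inE ?eqxx ?orbT.
  rewrite /= !inE !negb_or (BN _ _ Bq) (AN _ _ Aup) /=.
  by rewrite ![w == _]eq_sym ![u == q.1]eq_sym ![u == q.2]eq_sym
     ![p == q.1]eq_sym ![p == q.2]eq_sym uw pw q1w q2w q1u q2u q1p q2p.
have [u' u'L u'u] : exists2 u', u' \in L & u' != u.
  have /card_gt0P[u'] : 0 < #|L :\ u| by move: L2; rewrite (cardsD1 u) uL.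
  by rewrite !inE => /andP[uu' u'L]; exists u'.
have u'w : u' != w by apply: contraNneq wL => <-.
have [Auu'|nA] := boolP (A u u').
  have [|//|q [Bq]] := hB [set w; u; u']; first by apply: sub3 => //; exact: LSS.
  rewrite !inE !negb_or => /andP[/andP[q1w q1u] q1p] /andP[/andP[q2w q2u] q2p].
  exists (u, u'), q; split=> //.
    rewrite /= !inE !negb_or (BN _ _ Bq) (AN _ _ Auu') /=.
    by rewrite ![w == _]eq_sym ![u == q.1]eq_sym ![u == q.2]eq_sym
     ![u' == q.1]eq_sym ![u' == q.2]eq_sym uw u'w q1w q2w q1u q2u q1p q2p.
  by apply: (two u u'); rewrite ?inE ?eqxx ?orbT // eq_sym.
have [Buu'|nB] := boolP (B u u').
  have [|//|q [Aq]] := hA [set w; u; u']; first by apply: sub3 => //; exact: LSS.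
  rewrite !inE !negb_or => /andP[/andP[q1w q1u] q1p] /andP[/andP[q2w q2u] q2p].
  exists q, (u, u'); split=> //.
    rewrite /= !inE !negb_or (AN _ _ Aq) (BN _ _ Buu') /=.
    by rewrite ![w == _]eq_sym uw u'w q1w q2w q1u q2u q1p q2p.
  by apply: (two u u'); rewrite ?inE ?eqxx ?orbT // eq_sym.
pose NA x := [set y | A x y] :\ w; pose NB x := [set y | B x y] :\ w.
(* By edge-disjointness [w] is a neighbour of [x] in at most one of [A] and [B], so excluding it
   costs at most one of at least four neighbours. *)
have NAB x : x \in L -> [/\ 0 < #|NA x|, 0 < #|NB x| & 2 < #|NA x| + #|NB x|].
  move=> xL; have := dA _ xL; have := dB _ xL.
  rewrite /degree (cardsD1 w) [X in _ -> _ < X -> _](cardsD1 w) -/(NA x) -/(NB x) !inE.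
  move: (disAB x w) #|NA x| #|NB x|; clear.
  by case: (A x w); case: (B x w) => //= _ m n; split; lia.
have final x y : x \in L -> y \in L -> x != y -> x != w -> y != w ->
    ~~ A x y -> ~~ B x y -> 2 < #|NA x| + #|NB y| ->
  exists p q : V * V,
    [/\ A p.1 p.2, B q.1 q.2, uniq (w :: ends p ++ ends q)
      & 1 < #|L :&: [set x in w :: ends p ++ ends q]|].
  move=> xL yL xy xw yw nAxy nBxy big.
  have [Ax _ _] := NAB _ xL; have [_ By _] := NAB _ yL.
  have [p [q [+ + pq]]] := distinct_choice Ax By big.
  rewrite !inE => /andP[pw Axp] /andP[qw Byq].
  exists (x, p), (y, q); split=> //; last by apply: (two x y); rewrite ?inE ?eqxx ?orbT.
  have py : p != y by apply: contraNneq nAxy => <-.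
  have qx : q != x by apply: contraNneq nBxy => <-; rewrite sB.
  rewrite /= !inE !negb_or (AN _ _ Axp) (BN _ _ Byq) pq py xy.
  by rewrite ![w == _]eq_sym [x == q]eq_sym xw pw yw qw qx.
have [_ _ n1] := NAB _ uL; have [_ _ n2] := NAB _ u'L.
(* The four neighbourhood sizes sum to at least 6, so one of the two crossed sums is at least 3. *)
have [h|h] := leqP 3 (#|NA u| + #|NB u'|); first by apply: (final u u'); rewrite // eq_sym.
apply: (final u' u); rewrite // 1?sA 1?sB //.
by move: n1 n2 h; move: #|NA u| #|NB u| #|NA u'| #|NB u'|; clear; lia.
Qed.

(** * Leaf counts, and rainbows on at least ten vertices *)

Definition leaves S D j := [set v in S | D j v == 1].

Lemma leaves_disjoint S D j k v :
  valid S D -> v \in leaves S D j -> v \in leaves S D k -> j = k.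
Proof.
move=> [_ _ ncl]; rewrite !inE => /andP[vS /eqP vj] /andP[_ /eqP vk].
by apply/eqP; apply: contraTT isT => jk; move: (ncl v k j vS vk jk); rewrite vj.
Qed.

Lemma two_leaves S D j : valid S D -> 1 < #|leaves S D j|.
Proof.
move=> [d0 sd _].
have : 2 * #|S| <= \sum_(v in S) D j v + #|leaves S D j|.
  rewrite -sum1_card big_distrr /= -sum1dep_card big_mkcondr -big_split /=.
  by apply: leq_sum => v vS; have := d0 j v vS; case: eqP; lia.
by have := sd j; lia.
Qed.

Lemma sum_leaves S D : valid S D -> \sum_j #|leaves S D j| <= #|S|.
Proof.
move=> vD.
have -> : \sum_j #|leaves S D j| = \sum_(v in S) \sum_j (D j v == 1 : nat).
  rewrite exchange_big /=; apply: eq_bigr => j _.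
  by rewrite -sum1dep_card big_mkcondr.
rewrite -sum1_card; apply: leq_sum => v vS.
have [/existsP[i vi]|/existsPn none] := boolP [exists j, D j v == 1]; last first.
  by rewrite big1 // => j _; rewrite (negPf (none j)).
rewrite (bigD1 i) //= vi big1 // => j ji; case: (vD) => _ _ ncl.
by have := ncl v i j vS (eqP vi) ji; case: eqP => // ->.
Qed.

(** With leaf counts for [F], [c] is the tree with the fewest leaves; a constant [F] merely
    enumerates the indices. *)
Lemma other_three (F : 'I_4 -> nat) i : exists a b c : 'I_4,
  [/\ uniq [:: i; a; b; c], forall j, j \in [:: i; a; b; c], F c <= F a & F c <= F b].
Proof.
have [c0 c0i] : exists c0, c0 != i.
  by exists (if i == ord0 then ord_max else ord0); case: (eqVneq i ord0) => [->|] //; rewrite eq_sym.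
have [c ci cmin] := @arg_minnP _ c0 [pred c | c != i] F c0i.
have {}ci : c != i := ci.
have /cards2P[a [b [ab E]]] : #|~: [set i; c]| == 2.
  by rewrite cardsCs card_ord setCK cards2 [i == c]eq_sym ci.
have : a \in ~: [set i; c] by rewrite E !inE eqxx.
have : b \in ~: [set i; c] by rewrite E !inE eqxx orbT.
rewrite !inE !negb_or => /andP[bi bc] /andP[ai ac].
exists a, b, c; split; [|move=> j|exact: cmin|exact: cmin].
  by rewrite /= !inE !negb_or ![i == _]eq_sym ai bi ci ab ac bc.
have /setP/(_ j) := E; rewrite !inE.
by case: (j == i); case: (j == a); case: (j == b); case: (j == c).
Qed.

Lemma sum_four (F : 'I_4 -> nat) i a b c :
  uniq [:: i; a; b; c] -> (forall j, j \in [:: i; a; b; c]) ->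
  \sum_j F j = F i + F a + F b + F c.
Proof.
move=> us al; rewrite -(big_enum _ _ predT) /= (perm_big [:: i; a; b; c]) /=.
  by rewrite !big_cons big_nil addn0 !addnA.
by apply: uniq_perm; rewrite ?enum_uniq // => j; rewrite al mem_enum.
Qed.

(* T c is the tree other than T i with the fewest leaves, hence with at most
   (#|S| - 2) / 3 of them.  Five vertices covering its edges leave at least
   #|S| - 9 leaves outside, which is too many if two leaves are inside. *)
Lemma rainbow_large S D T i w :
  valid S D -> realizes S D T -> 9 < #|S| -> w \in S -> exists f, rainbow T i w f.
Proof.
move=> vD [tT dT disT] S10 wS.
have [a [b [c [uabc al ca cb]]]] := other_three (fun j => #|leaves S D j|) i.
have := sum_leaves vD; rewrite (sum_four _ uabc al).
have := (two_leaves i vD, two_leaves a vD, two_leaves b vD, two_leaves c vD).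
move=> [[[Li La] Lb] Lc] sumL.
case: (vD) => d0 sd ncl.
have free j U : U \subset S -> 2 * #|U| + #|leaves S D j :\: U| <= #|S| ->
    exists p : V * V, [/\ T j p.1 p.2, p.1 \notin U & p.2 \notin U].
  move=> US small; case: (tT j) => sj _ Sj _ _.
  apply: (exists_uncovered_edge sj Sj (dT j) (d0 j) (sd j) US).
  by rewrite (_ : [set x in _ | _] = leaves S D j :\: U) //; apply/setP => x; rewrite !inE andbA.
have deg j u : j != c -> u \in leaves S D c -> 1 < degree (T j) u.
  by move=> jc; rewrite inE => /andP[uS /eqP uc]; rewrite dT //; apply: ncl uc _.
(* The other three leaf sets are counted with at least two vertices each. The same 6 is twice the
   three vertices to be avoided in [free3]. *)
have small_leaves : #|leaves S D a| + 6 <= #|S| /\ #|leaves S D b| + 6 <= #|S|.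
  move: sumL Li La Lb Lc; move: #|leaves S D i| #|leaves S D a| #|leaves S D b|.
  by move: #|leaves S D c| #|S|; clear; lia.
have free3 j U : #|leaves S D j| + 6 <= #|S| -> U \subset S -> #|U| <= 3 -> exists p : V * V, [/\ T j p.1 p.2, p.1 \notin U & p.2 \notin U].
  move=> small US U3; apply: free => //.
  move: (subset_leq_card (subsetDl (leaves S D j) U)) small U3; clear; lia.
move: (uabc); rewrite /= !inE !negb_or => /and4P[/and3P[ia ib ic] /andP[ab ac] bc _].
have LS : leaves S D c \subset S by apply/subsetP => x; rewrite inE => /andP[].
have [||p [q [Ap Bq upq Lpq]]] := disjoint_edges_covering_leaves (tT a) (tT b)
    (disT _ _ ab) (fun u => deg a u ac) (fun u => deg b u bc) LS wS Lc.
- by move=> U; apply: free3; case: small_leaves.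
- by move=> U; apply: free3; case: small_leaves.
set U := [set x in _] in Lpq.
have TS j x y : T j x y -> x \in S by case: (tT j) => _ _ + _ _; exact.
have TS2 j x y : T j x y -> y \in S by case: (tT j) => se _ _ _ _; rewrite se; exact: TS.
have US : U \subset S.
  apply/subsetP => x; rewrite !inE.
  by case/or4P => [/eqP->|/eqP->|/eqP->|/orP[]/eqP->] //; [exact: TS Ap|exact: TS2 Ap|exact: TS Bq|exact: TS2 Bq].
have U5 : #|U| <= 5 by rewrite cardsE; apply: leq_trans (card_size _) _.
have [|r [Tr r1 r2]] := free c U US.
  (* With five vertices in [U], two of them leaves of [T c], the requirement becomes
     [8 + #|leaves S D c| <= #|S|]. It is sharp on ten vertices, where [T c] has exactly two
     leaves. *)
  move: (cardsID U (leaves S D c)) U5 Lpq sumL ca cb Li S10 => /=.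
  move: #|U| #|_ :&: U| #|_ :\: U| #|leaves S D i| #|leaves S D a| #|leaves S D b|.
  by move: #|leaves S D c| #|S|; clear; lia.
pose f j := if j == a then p else if j == b then q else r.
have fa : f a = p by rewrite /f eqxx.
have fb : f b = q by rewrite /f eq_sym (negPf ab) eqxx.
have fc : f c = r by rewrite /f ![c == _]eq_sym (negPf ac) (negPf bc).
have rU x : x \in ends r -> x \notin U by rewrite !in_cons orbF => /orP[] /eqP->.
move: upq; rewrite cons_uniq cat_uniq mem_cat negb_or.
case/andP=> /andP[wp wq] /and3P[_ /hasPn pq _].
have wr : w \notin ends r.
  by apply/negP => /rU; rewrite in_set mem_head.
have pqF x : x \in ends p -> x \in ends q -> False.
  by move=> xp /pq; rewrite /= xp.
have prF x : x \in ends p -> x \in ends r -> False.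
  by move=> xp /rU; rewrite in_set in_cons mem_cat xp orbT.
have qrF x : x \in ends q -> x \in ends r -> False.
  by move=> xp /rU; rewrite in_set in_cons mem_cat xp !orbT.
have cases j : j != i -> [\/ j = a, j = b | j = c].
  move=> ji; move: (al j); rewrite !inE (negPf ji) /=.
  by case/or3P=> /eqP; [constructor 1|constructor 2|constructor 3].
exists f; split=> [j /cases[] ->|j k x /cases[] -> /cases[] ->];
  rewrite ?fa ?fb ?fc //.
- by move=> /pqF H /H.
- by move=> /prF H /H.
- by move=> xq /pqF; case.
- by move=> /qrF H /H.
- by move=> xq /prF; case.
- by move=> xq /qrF; case.
Qed.

End Realizations.

(** * Tight vertices and the deletion of a tight leaf *)

Section Reduction.

Variable V : finType.
Implicit Types (S U : {set V}) (v w x y : V) (i j : 'I_4).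
Implicit Types (D : 'I_4 -> V -> nat) (T : 'I_4 -> rel V) (f : 'I_4 -> V * V).

Lemma leaf_or_internal D v : (exists i, D i v = 1) \/ (forall j, D j v != 1).
Proof.
have [/existsP[i /eqP Di]|/existsPn none] := boolP [exists j, D j v == 1].
  by left; exists i.
by right.
Qed.

(** A leaf of one tree contributes at least 1 + 2 + 2 + 2, any other vertex at least 8; hence 7
    forces the tight pattern. *)
Lemma column_sum S D v : valid S D -> v \in S ->
  7 <= \sum_j D j v /\
  (\sum_j D j v = 7 -> exists i, forall j, D j v = if j == i then 1 else 2).
Proof.
move=> [d0 _ ncl] vS; have [[i Di]|none] := leaf_or_internal D v; last first.
  have : 8 <= \sum_j D j v.
    rewrite (_ : 8 = \sum_(j < 4) 2); last by rewrite sum_nat_const card_ord.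
    by apply: leq_sum => j _; have := d0 j v vS; have := none j; case: (D j v) => [|[]].
  by move=> h; split; [apply: leq_trans h|move=> E; rewrite E in h].
have [a [b [c [u al _ _]]]] := other_three (fun=> 0) i.
rewrite (sum_four _ u al) Di; move: u; rewrite /= !inE !negb_or.
case/and4P=> /and3P[ia ib ic] _ _ _.
have [Da Db Dc] : [/\ 1 < D a v, 1 < D b v & 1 < D c v].
  by split; apply: ncl vS Di _; rewrite // eq_sym.
split=> [|E]; first by move: Da Db Dc; clear; lia.
have [Ea Eb Ec] : [/\ D a v = 2, D b v = 2 & D c v = 2].
  by split; move: E Da Db Dc; clear; lia.
exists i => j; case: eqVneq => [->//|ji].
by move: (al j); rewrite !inE (negPf ji) /= => /or3P[] /eqP->.
Qed.

Lemma total_degree S D : valid S D -> \sum_(v in S) \sum_j D j v + 8 = 8 * #|S|.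
Proof.
move=> [_ sd _]; rewrite exchange_big /=.
have : \sum_j (\sum_(v in S) D j v + 2) = \sum_(j < 4) 2 * #|S| by apply: eq_bigr.
by rewrite big_split /= !sum_nat_const !card_ord; lia.
Qed.

Definition tight S D := [set v in S | \sum_j D j v == 7].

(** The total degree is 8 below [8 * #|S|], and only tight vertices contribute less than 8, each by
    exactly one. *)
Lemma eight_tight S D : valid S D -> 8 <= #|tight S D|.
Proof.
move=> vD; have total := total_degree vD.
have : 8 * #|S| <= \sum_(v in S) \sum_j D j v + #|tight S D|.
  rewrite -sum1_card big_distrr /= -sum1dep_card big_mkcondr -big_split /=.
  apply: leq_sum => v vS; have [+ _] := column_sum vD vS.
  by rewrite leq_eqVlt eq_sym; case: eqP => [->|_ /=] //; lia.
by move: total; move: (\sum_(v in S) _) #|S| #|tight S D|; clear; lia.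
Qed.

Lemma leaves_of_path S D j : valid S D -> (forall v, v \in S -> D j v <= 2) ->
  #|leaves S D j| = 2.
Proof.
move=> [d0 sd _] D2.
have : 2 * #|S| = \sum_(v in S) D j v + #|leaves S D j|.
  rewrite -sum1_card big_distrr /= -sum1dep_card big_mkcondr -big_split /=.
  apply: eq_bigr => v vS; move: (d0 j v vS) (D2 v vS).
  by case: (D j v) => [|[|[]]].
by move: (sd j); move: (\sum_(v in S) _) #|S| #|_|; clear; lia.
Qed.

Definition decrease D i w : 'I_4 -> V -> nat :=
  fun j x => D j x - ((j == i) && (x == w)).

Lemma decreaseK S D i w j x : valid S D -> x \in S ->
  D j x = decrease D i w j x + ((j == i) && (x == w)).
Proof. by move=> [d0 _ _] xS; have := d0 j x xS; rewrite /decrease; case: (_ && _); lia. Qed.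

(** Lowering [D i w] must not create a common leaf: either [w] remains internal in tree [i], or it
    is internal in all other trees. Tree [i] loses 1 at [v] and 1 at [w], the others lose 2 at [v],
    as deleting a vertex requires. *)
Lemma valid_decrease S D i v w :
  valid S D -> v \in S -> w \in S -> w != v ->
  (forall j, D j v = if j == i then 1 else 2) ->
  2 < D i w \/ (forall j, 1 < D j w) -> valid (S :\ v) (decrease D i w).
Proof.
move=> vD vS wS wv Dv h; have [d0 sd ncl] := vD.
have Diw : 1 < D i w by case: h => [/ltnW|].
split=> [j x|j|x k j].
- rewrite !inE => /andP[_ xS]; have := d0 j x xS; rewrite /decrease.
  by case: eqP => [->|_]; case: eqP => [->|_] /=; lia.
- have : \sum_(x in S) D j x = D j v + \sum_(x in S :\ v) decrease D i w j x + (j == i).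
    rewrite (big_setD1 v) //= -addnA; congr (_ + _).
    rewrite (eq_bigr (fun x => decrease D i w j x + ((j == i) && (x == w)))); last first.
      by move=> x; rewrite inE => /andP[_ xS]; apply: decreaseK xS.
    rewrite big_split /=; congr (_ + _).
    rewrite (bigD1 w) ?inE ?wv //= eqxx andbT big1 ?addn0 // => x /andP[_ /negPf->].
    by rewrite andbF.
  move: (sd j) (cardsD1 v S); rewrite vS Dv.
  by case: (j == i); move: (\sum_(x in S) D j x) (\sum_(x in S :\ v) decrease D i w j x) #|S| #|_|; clear; lia.
rewrite !inE => /andP[_ xS]; rewrite /decrease.
have [->|xw] := eqVneq x w; last by rewrite !andbF !subn0 => Dk; apply: ncl xS Dk.
rewrite !andbT => Dk jk; have [ki|ki] := eqVneq k i; have [ji|ji] := eqVneq j i.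
- by rewrite ki ji eqxx in jk.
- rewrite ki eqxx in Dk; rewrite subn0; case: h => // h.
  by exfalso; move: h Dk; clear; lia.
- rewrite (negPf ki) subn0 in Dk; case: h => [|/(_ k)]; last by rewrite Dk.
  by rewrite ji; clear; lia.
- by rewrite (negPf ki) subn0 in Dk; rewrite subn0; apply: ncl wS Dk jk.
Qed.

(* If no vertex is internal in all four trees and no tree offers both a vertex
   of degree at least 3 and a tight leaf, then the tight vertices are leaves of
   the at most three trees that are paths, so there are at most six of them. *)
Lemma exists_reduction S D : valid S D -> 8 < #|S| ->
  exists i v w, [/\ v \in S, w \in S :\ v, forall j, D j v = if j == i then 1 else 2
    & valid (S :\ v) (decrease D i w)].
Proof.
move=> vD S8; have [d0 sd ncl] := vD; have T8 := eight_tight vD.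
have tightE v : v \in tight S D -> v \in S /\ exists i, forall j, D j v = if j == i then 1 else 2.
  by rewrite inE => /andP[vS /eqP E]; split=> //; case: (column_sum vD vS) => _; exact.
have [/exists_inP[w wS /forallP wD]|noA] := boolP [exists w in S, [forall j, 1 < D j w]].
  have /card_gt0P[v /tightE[vS [i Dv]]] : 0 < #|tight S D| by apply: leq_trans T8.
  have wv : w != v by apply/eqP => E; move: (wD i); rewrite E Dv eqxx.
  exists i, v, w; rewrite !inE wv wS; split=> //.
  by apply: valid_decrease => //; right.
pose high j := [exists w in S, 2 < D j w].
have [/exists_inP[v vt /existsP[i /andP[/eqP Di /exists_inP[w wS wi]]]]|noB] :=
    boolP [exists v in tight S D, [exists i, (D i v == 1) && high i]].
  have [vS [k Dv]] := tightE _ vt.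
  have ik : i = k by apply/eqP; move: Di; rewrite Dv; case: eqP.
  subst k; have wv : w != v by apply/eqP => E; rewrite E Di in wi.
  exists i, v, w; rewrite !inE wv wS; split=> //.
  by apply: valid_decrease => //; left.
exfalso.
have low j : ~~ high j -> forall v, v \in S -> D j v <= 2.
  by move=> /exists_inPn h v /h; rewrite -leqNgt.
(* If all four trees were paths, every vertex, being a leaf somewhere by [noA], would contribute at
   most 7, forcing [8 * #|S| - 8 <= 7 * #|S|]. *)
have [i hi] : exists i, high i.
  apply/existsP; apply: contraTT S8 => /existsPn nohigh; rewrite -leqNgt.
  have total := total_degree vD.
  have : \sum_(v in S) \sum_j D j v <= 7 * #|S|.
    rewrite -sum1_card big_distrr /=; apply: leq_sum => v vS.
    have /exists_inPn/(_ v vS)/forallPn[i Di] := noA.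
    rewrite (bigD1 i) //= (_ : 7 * 1 = 1 + \sum_(j < 4 | j != i) 2); last first.
      by rewrite sum_nat_const cardC1 card_ord.
    apply: leq_add; first by rewrite leqNgt.
    by apply: leq_sum => j _; apply: low (nohigh j) _ vS.
  by move: total; move: (\sum_(v in S) _) #|S|; clear; lia.
suff : #|tight S D| <= 6 by move: T8; clear; lia.
apply: (@leq_trans (\sum_j \sum_(v in S) (~~ high j && (D j v == 1) : nat))).
  rewrite exchange_big /= -sum1dep_card big_mkcondr; apply: leq_sum => v vS.
  case: ifP => // vt; have vt' : v \in tight S D by rewrite inE vS.
  have [_ [k Dk]] := tightE v vt'; rewrite (bigD1 k) //= Dk eqxx.
  move/exists_inPn/(_ v): noB; rewrite vt' => /(_ isT)/existsPn/(_ k).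
  by rewrite Dk eqxx /= => ->.
rewrite (bigD1 i) //= big1 ?hi // add0n.
rewrite (_ : 6 = \sum_(j < 4 | j != i) 2); last by rewrite sum_nat_const cardC1 card_ord.
apply: leq_sum => j _; have [hj|hj] := boolP (high j); first by rewrite big1.
by rewrite -(leaves_of_path vD (low j hj)) /= -sum1dep_card big_mkcondr.
Qed.

End Reduction.

(** * Explicit edge lists and computations on 8 and 9 labels *)

Definition zigzag i : seq nat := [seq (i + s) %% 8 | s <- [:: 0; 7; 1; 6; 2; 5; 3; 4]].

Definition path_edges (p : seq nat) : seq (nat * nat) := zip (behead p) p.

(** The rotations of the zigzag 0, -1, 1, -2, 2, -3, 3, -4 modulo 8. Consecutive labels of path [j]
    sum to 2j - 1 or 2j modulo 8, so the paths are edge-disjoint. Path [j] ends at [j] and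
    [j + 4]. *)
Definition edges8 : seq (seq (nat * nat)) := [seq path_edges (zigzag j) | j <- iota 0 4].

Definition eswap (p : nat * nat) := (p.2, p.1).

(** The counterpart of [insert] on edge lists, with label 8 for the new vertex; the subdivided edge
    is removed in both orientations. *)
Definition edges9 i w (g : seq (nat * nat)) : seq (seq (nat * nat)) :=
  [seq let E := nth [::] edges8 j in let p := nth (0, 0) g j in
       if j == i then (w, 8) :: E
       else [:: (p.1, 8), (p.2, 8) & [seq q <- E | (q != p) && (q != eswap p)]]
  | j <- iota 0 4].

Definition disjoint_pairs (p q : nat * nat) : bool :=
  [&& p.1 != q.1, p.1 != q.2, p.2 != q.1 & p.2 != q.2].

(** The bound [m] is tested as well, because labels name distinct vertices only below [m]. *)
Definition is_rainbow m (E : seq (seq (nat * nat))) i w (g : seq (nat * nat)) : bool :=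
  let e := nth (0, 0) g in
  all (fun j => (j == i) ||
        [&& e j \in nth [::] E j, (e j).1 < m, (e j).2 < m, w != (e j).1 & w != (e j).2] &&
        all (fun k => [|| k == i, j == k | disjoint_pairs (e j) (e k)]) (iota 0 4))
      (iota 0 4).

Fixpoint disjoint_choices (E : seq (seq (nat * nat))) (used : seq nat) : seq (seq (nat * nat)) :=
  if E is Ej :: E' then
    flatten [seq [seq p :: g | g <- disjoint_choices E' [:: p.1, p.2 & used]]
            | p <- Ej & (p.1 \notin used) && (p.2 \notin used)]
  else [:: [::]].

(* Tree i is replaced by a dummy edge on two unused labels, so that the chosen
   edges are indexed by all four trees. The search is not verified: its outcome
   is rechecked by is_rainbow. *)
Definition find_rainbow E i w : seq (nat * nat) :=
  head [::] (disjoint_choices (set_nth [::] E i [:: (9, 10)]) [:: w]).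

Lemma rainbow8 : all (fun i => all (fun w =>
  is_rainbow 8 edges8 i w (find_rainbow edges8 i w)) (iota 0 8)) (iota 0 4).
Proof. by vm_compute. Qed.

(** The rainbow for the first insertion is the one picked by [find_rainbow], which leaves 32
    realizations on nine labels, each tested for 36 pairs. *)
Lemma rainbow9 : all (fun i => all (fun w =>
  let E := edges9 i w (find_rainbow edges8 i w) in
  all (fun i' => all (fun w' => is_rainbow 9 E i' w' (find_rainbow E i' w'))
      (iota 0 9)) (iota 0 4)) (iota 0 8)) (iota 0 4).
Proof. by vm_compute. Qed.

(** * From labels to vertices, the base case and the induction *)

Section Base.

Variable V : finType.
Implicit Types (S U : {set V}) (v w : V) (x : nat -> V) (i j : 'I_4).
Implicit Types (D : 'I_4 -> V -> nat) (T : 'I_4 -> rel V).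

Definition at_labels x (p : nat * nat) : V * V := (x p.1, x p.2).

Lemma is_rainbowP m E i a g j : is_rainbow m E i a g -> j != i ->
  let p := nth (0, 0) g j in
    [/\ p \in nth [::] E j, p.1 < m, p.2 < m, a != p.1 & a != p.2] /\
    forall k : 'I_4, k != i -> j != k -> disjoint_pairs p (nth (0, 0) g k).
Proof.
move=> /allP/(_ j); rewrite mem_iota ltn_ord => /(_ isT) rb ji p.
move: rb; rewrite (inj_eq val_inj) (negPf ji) orFb => /andP[/and5P[? ? ? ? ?] /allP al].
split=> // k ki jk; move: (al k); rewrite mem_iota ltn_ord => /(_ isT).
by rewrite !(inj_eq val_inj) (negPf ki) (negPf jk).
Qed.

Lemma rainbow_labels x m E T i a g :
  {in gtn m &, injective x} ->
  (forall j p, p \in nth [::] E j -> T j (x p.1) (x p.2)) ->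
  a < m -> is_rainbow m E i a g ->
  rainbow T i (x a) (fun j => at_labels x (nth (0, 0) g j)).
Proof.
move=> xI ET am rb.
have xE b c : b < m -> c < m -> (x b == x c) = (b == c).
  by move=> bm cm; apply/eqP/eqP => [/xI-> //|->].
split=> [j /(is_rainbowP rb)/= [[pE p1 p2 a1 a2] _]|j k y ji ki].
  by split; [exact: ET | rewrite !inE !xE // negb_or a1 a2].
have [jk|jk] := eqVneq j k; first by [].
have /= [[_ p1 p2 _ _] /(_ k ki jk)] := is_rainbowP rb ji.
have /= [[_ q1 q2 _ _] _] := is_rainbowP rb ki.
case/and4P=> n1 n2 n3 n4; rewrite !inE => /orP[] /eqP->; rewrite !xE //.
  by rewrite (negPf n1) (negPf n2).
by rewrite (negPf n3) (negPf n4).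
Qed.

(** Since there are eight tight vertices, they fill [S]; every tree is then a path, and the leaf
    pairs of the four trees partition [S]. Label [k] goes to leaf number [k %/ 4] of tree [k %% 4],
    matching the ends of the zigzags. *)
Lemma labels8 S D : valid S D -> #|S| <= 8 -> exists x : nat -> V,
  [/\ {in gtn 8 &, injective x}, S = [set z in map x (iota 0 8)]
    & forall j k, k < 8 -> D j (x k) = if (j : nat) == k %% 4 then 1 else 2].
Proof.
move=> vD S8; have T8 := eight_tight vD.
have TS : tight S D = S.
  by apply/eqP; rewrite eqEcard (leq_trans S8 T8) andbT; apply/subsetP => v; rewrite inE => /andP[].
have cS : #|S| = 8 by apply/eqP; rewrite eqn_leq S8 -TS T8.
have Dv v : v \in S -> exists i, forall j, D j v = if j == i then 1 else 2.
  move=> vS; move: (vS); rewrite -{1}TS inE => /andP[_ /eqP E].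
  by case: (column_sum vD vS) => _; exact.
have L2 j : #|leaves S D j| = 2.
  by apply: leaves_of_path => // v /Dv[i ->]; case: ifP.
have /card_gt0P[v0 _] : 0 < #|S| by rewrite cS.
pose x k := nth v0 (enum (leaves S D (inord (k %% 4)))) (k %/ 4).
have xL k : k < 8 -> x k \in leaves S D (inord (k %% 4)).
  by move=> k8; rewrite -mem_enum mem_nth // -cardE L2 ltn_divLR.
have k4 k : (inord (k %% 4) : 'I_4) = k %% 4 :> nat by rewrite inordK // ltn_mod.
have xI : {in gtn 8 &, injective x}.
  move=> k l k8 l8 E.
  have kl : inord (k %% 4) = inord (l %% 4) :> 'I_4.
    by apply: (leaves_disjoint vD (xL k k8)); rewrite E; exact: xL.
  have kl' : k %% 4 = l %% 4 by rewrite -(k4 k) kl k4.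
  move/eqP: E; rewrite /x kl nth_uniq ?enum_uniq -?cardE ?L2 ?ltn_divLR // => /eqP E.
  by rewrite (divn_eq k 4) (divn_eq l 4) E kl'.
have xS k : k < 8 -> x k \in S by move/xL; rewrite inE => /andP[].
exists x; split=> [//||j k k8].
  apply/esym/eqP; rewrite eqEcard; apply/andP; split.
    apply/subsetP => z; rewrite inE => /mapP[k]; rewrite mem_iota => /andP[_ k8] ->.
    exact: xS.
  rewrite cS cardsE (card_uniqP _) ?size_map ?size_iota //.
  rewrite map_inj_in_uniq ?iota_uniq // => k l; rewrite !mem_iota => k8 l8; exact: xI.
have := xL k k8; rewrite inE => /andP[xkS]; have [i Di] := Dv _ xkS.
rewrite !Di; case: (eqVneq (inord (k %% 4)) i) => [<- _|//].
by rewrite -(inj_eq val_inj) /= k4.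
Qed.

Lemma map_zip_pair x s t : map (at_labels x) (zip s t) = zip (map x s) (map x t).
Proof. by elim: s t => [|a s IH] [|b t] //=; rewrite IH. Qed.

Definition trees8 x : 'I_4 -> rel V :=
  fun j => edge_rel (map (at_labels x) (nth [::] edges8 j)).

Lemma nth_edges8 j : nth [::] edges8 j = path_edges (zigzag j).
Proof. by rewrite (@nth_map nat 0) ?size_iota // nth_iota. Qed.

Lemma edges8_small : all (all (fun p : nat * nat => (p.1 < 8) && (p.2 < 8))) edges8.
Proof. by []. Qed.

Lemma edges8_disjoint : all (fun j : nat => all (fun k : nat => (j == k) ||
  all (fun p => (p \notin nth [::] edges8 k) && (eswap p \notin nth [::] edges8 k))
      (nth [::] edges8 j)) (iota 0 4)) (iota 0 4).
Proof. by vm_compute. Qed.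

Lemma edges8_lt j p : p \in nth [::] edges8 j -> p.1 < 8 /\ p.2 < 8.
Proof.
move=> pE; have /allP/(_ (nth [::] edges8 j)) := edges8_small.
by rewrite mem_nth ?size_map // => /(_ isT)/allP/(_ p pE)/andP.
Qed.

Lemma realizes_base S D x :
  {in gtn 8 &, injective x} -> S = [set z in map x (iota 0 8)] ->
  (forall j k, k < 8 -> D j (x k) = if (j : nat) == k %% 4 then 1 else 2) ->
  realizes S D (trees8 x).
Proof.
move=> xI SE Dx.
have xE b c : b < 8 -> c < 8 -> (x b == x c) = (b == c).
  by move=> bm cm; apply/eqP/eqP => [/xI-> //|->].
have zz j : [/\ perm_eq (zigzag j) (iota 0 8) & zigzag j = head 0 (zigzag j) :: behead (zigzag j)].
  by case: j => -[|[|[|[]]]].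
have us j : uniq (map x (zigzag j)).
  have [pz _] := zz j; rewrite map_inj_in_uniq ?(perm_uniq pz) ?iota_uniq // => k l.
  by rewrite !(perm_mem pz) !mem_iota => k8 l8; exact: xI.
have Sz j : S = [set z in map x (zigzag j)].
  by rewrite SE; apply/setP => z; rewrite !in_set; apply: perm_mem; rewrite perm_map // perm_sym; case: (zz j).
have TE j : trees8 x j = edge_rel (zip (map x (behead (zigzag j))) (map x (zigzag j))).
  by rewrite /trees8 nth_edges8 map_zip_pair.
split=> [j|j v vS|j k jk u v].
- have := us j; rewrite TE (Sz j); have [_ ->] := zz j; exact: tree_path.
- move: vS; rewrite SE in_set => /mapP[k]; rewrite mem_iota => /andP[_ k8] ->.
  have kz : x k \in map x (zigzag j).
    by rewrite map_f // (perm_mem (_ : perm_eq _ (iota 0 8))) ?mem_iota //; case: (zz j).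
  rewrite Dx // TE; have := us j; move: kz; have [_ ->] := zz j.
  move=> kz u; rewrite [behead _]/= degree_path // last_map !xE //;
   case: j {kz u} => -[|[|[|[]]]] //= _; by move: k k8; do 8?case=> //.
apply/negP => /andP[]; rewrite /trees8 !edge_relE.
have dis p q : p \in nth [::] edges8 j -> q \in nth [::] edges8 k ->
    at_labels x q = at_labels x p \/ at_labels x q = at_labels x (eswap p) -> False.
  move=> pj qk; have [p1 p2] := edges8_lt pj; have [q1 q2] := edges8_lt qk.
  have /allP/(_ j) := edges8_disjoint; rewrite mem_iota ltn_ord => /(_ isT)/allP/(_ k).
  rewrite mem_iota ltn_ord (inj_eq val_inj) (negPf jk) => /(_ isT)/allP/(_ p pj).
  case/andP=> /negP n1 /negP n2 [] [/eqP + /eqP].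
    rewrite !xE // => /eqP E1 /eqP E2; case: n1.
    by rewrite (surjective_pairing p) -E1 -E2 -surjective_pairing.
  rewrite !xE // => /eqP E1 /eqP E2; case: n2.
  by rewrite /eswap -E1 -E2 -surjective_pairing.
case/orP=> /mapP[p pj Ep] /orP[] /mapP[q qk Eq]; apply: (dis p q pj qk).
- by left; rewrite -Ep.
- by right; rewrite -Eq; case: Ep => -> ->.
- by right; rewrite -Eq; case: Ep => -> ->.
- by left; rewrite -Ep.
Qed.

Lemma trees8_edge x j p : p \in nth [::] edges8 j -> trees8 x j (x p.1) (x p.2).
Proof. by move=> pE; rewrite /trees8 edge_relE (map_f (at_labels x) pE). Qed.

Definition extend_labels x v : nat -> V := fun k => if k == 8 then v else x k.

(** A rainbow asks that its edges belong to the trees, so this inclusion carries [rainbow9] over to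
    the inserted trees. *)
Lemma edges9_sub x v i a g :
  {in gtn 8 &, injective x} -> a < 8 -> is_rainbow 8 edges8 i a g ->
  forall j p, p \in nth [::] (edges9 i a g) j ->
  insert (trees8 x) i (x a) (fun j => at_labels x (nth (0, 0) g j)) v j
    (extend_labels x v p.1) (extend_labels x v p.2).
Proof.
move=> xI a8 rb j p; set x' := extend_labels x v.
have xE b c : b < 8 -> c < 8 -> (x b == x c) = (b == c).
  by move=> bm cm; apply/eqP/eqP => [/xI-> //|->].
have x'x b : b < 8 -> x' b = x b by rewrite /x' /extend_labels; case: eqP => // ->.
rewrite /edges9 (nth_map 0) ?size_iota // nth_iota // add0n (inj_eq val_inj) /insert.
have [-> | ji] := eqVneq j i.
  rewrite inE => /orP[/eqP->|pE].
    by rewrite /add_leaf /link /= x'x // /x' /extend_labels !eqxx orbT.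
  by have [p1 p2] := edges8_lt pE; rewrite /add_leaf !x'x // trees8_edge.
have /= [[gE g1 g2 _ _] _] := is_rainbowP rb ji.
set q := nth (0, 0) g j in gE g1 g2 *.
rewrite !inE mem_filter => /or3P[/eqP->|/eqP->|/andP[/andP[pq pq'] pE]].
- by rewrite /subdivide /link /= x'x // /x' /extend_labels !eqxx !orbT.
- by rewrite /subdivide /link /= x'x // /x' /extend_labels !eqxx !orbT.
have [p1 p2] := edges8_lt pE.
rewrite /subdivide !x'x // trees8_edge //= /link /= !xE //.
apply/orP; left; move: pq pq'; rewrite /eswap; case: (p) (q) => b c [d e].
by rewrite !xpair_eqE /= negb_or => -> ->.
Qed.

Definition extendable S T : Prop := forall i w, w \in S -> exists f, rainbow T i w f.

Lemma realizes_reduction S D i v w T f :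
  valid S D -> v \in S -> w \in S :\ v -> (forall j, D j v = if j == i then 1 else 2) ->
  realizes (S :\ v) (decrease D i w) T -> rainbow T i w f ->
  realizes S D (insert T i w f v).
Proof.
move=> vD vS wS Dv rT rf; rewrite -(setD1K vS).
apply: realizes_insert rT wS _ rf _ Dv; first by rewrite !inE eqxx.
by move=> j y; rewrite inE => /andP[_ yS]; apply: decreaseK vD yS.
Qed.

(** Extendability strengthens the induction hypothesis, as each insertion consumes a rainbow of the
    smaller realization. *)
Lemma exists_extendable S D :
  valid S D -> exists T, realizes S D T /\ extendable S T.
Proof.
have [n] := ubnP #|S|; elim: n S D => // n IH S D; rewrite ltnS => Sn vD.
have [S8|S8] := leqP #|S| 8.
  have [x [xI SE Dx]] := labels8 vD S8.
  exists (trees8 x); split; first exact: realizes_base.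
  move=> i w; rewrite SE in_set => /mapP[a]; rewrite mem_iota => /andP[_ a8] ->.
  have /allP/(_ i) := rainbow8; rewrite mem_iota ltn_ord => /(_ isT)/allP/(_ a).
  rewrite mem_iota => /(_ a8) rb.
  by eexists; apply: rainbow_labels xI _ a8 rb => j p; exact: trees8_edge.
have [i [v [w [vS wS Dv vD']]]] := exists_reduction vD S8.
have cS := cardsD1 v S; rewrite vS in cS.
have [S9|S9] := leqP #|S| 9; last first.
  have [|T [rT eT]] := IH (S :\ v) _ _ vD'; first by rewrite -add1n -cS.
  have [f rf] := eT i w wS; exists (insert T i w f v).
  have rT' := realizes_reduction vD vS wS Dv rT rf.
  by split=> // k y yS; apply: rainbow_large rT' S9 yS.
(* On nine vertices the induction hypothesis would not reveal its trees, so the insertion is made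
   into the explicit [trees8], where [rainbow9] applies. *)
have S'8 : #|S :\ v| <= 8 by rewrite -ltnS -add1n -cS.
have [x [xI SE Dx]] := labels8 vD' S'8.
have rT := realizes_base xI SE Dx.
move: (wS); rewrite SE in_set => /mapP[a]; rewrite mem_iota => /andP[_ a8] wa.
set g := find_rainbow edges8 i a.
have rb : is_rainbow 8 edges8 i a g.
  have /allP/(_ i) := rainbow8; rewrite mem_iota ltn_ord => /(_ isT)/allP/(_ a).
  by rewrite mem_iota; apply.
have rf : rainbow (trees8 x) i w (fun j => at_labels x (nth (0, 0) g j)).
  by rewrite wa; apply: rainbow_labels xI _ a8 rb => j p; exact: trees8_edge.
exists (insert (trees8 x) i w (fun j => at_labels x (nth (0, 0) g j)) v).
split; first exact: realizes_reduction rf.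
pose x' := extend_labels x v.
have xS k : k < 8 -> x k \in S :\ v.
  by move=> k8; rewrite SE in_set map_f // mem_iota.
have xv k : k < 8 -> x k != v by move/xS; rewrite !inE => /andP[].
have x'I : {in gtn 9 &, injective x'}.
  move=> k l; rewrite !inE !ltnS /x' /extend_labels [k <= 8]leq_eqVlt [l <= 8]leq_eqVlt.
  case: (eqVneq k 8) => [->|_] /=; case: (eqVneq l 8) => [->|_] //=.
  - by move=> _ /xv/eqP ne E; case: ne.
  - by move=> /xv/eqP ne _ E; case: ne.
  - exact: xI.
move=> k y yS.
have [b b9 ->] : exists2 b, b < 9 & y = x' b.
  have [->|yv] := eqVneq y v; first by exists 8.
  have : y \in S :\ v by rewrite !inE yv.
  rewrite SE in_set => /mapP[b]; rewrite mem_iota => /andP[_ b8] ->.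
  by exists b; [exact: ltnW | rewrite /x' /extend_labels; case: eqP b8 => // ->].
have /allP/(_ i) := rainbow9; rewrite mem_iota ltn_ord => /(_ isT)/allP/(_ a).
rewrite mem_iota => /(_ a8)/allP/(_ k); rewrite mem_iota ltn_ord => /(_ isT)/allP/(_ b).
rewrite mem_iota => /(_ b9) rb9.
eexists; apply: rainbow_labels x'I _ b9 rb9 => j p pE.
by rewrite wa; apply: edges9_sub rb _ _ pE.
Qed.

End Base.

Theorem theorem2 (n : nat) (D : 'I_4 -> 'I_n -> nat)
    (hD : forall i : 'I_4, tree_degree_sequence (D i))
    (hleaves : no_common_leaves D) :
  exists T : 'I_4 -> rel 'I_n,
    [/\ forall i : 'I_4, is_tree (T i),
        forall (i : 'I_4) (v : 'I_n), degree (T i) v = D i v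
      & forall i j : 'I_4, i != j -> edge_disjoint (T i) (T j)].
Proof.
have vD : valid [set: 'I_n] D.
  split=> [j v _|j|v i j _].
  - by case: (hD j) => + _; apply.
  - case: (hD j) => _; rewrite cardsT card_ord => <-; congr (_ + _).
    by apply: eq_bigl => v; rewrite inE.
  - by move=> /(hleaves v i); apply.
have [T [[tT dT disT] _]] := exists_extendable vD.
exists T; split=> // [j|j v]; last by rewrite dT ?inE.
have [se ie _ ce ae] := tT j.
split=> //; split=> [|x y]; last by apply: ce; rewrite inE.
(* The vertex set is nonempty because it contains eight tight vertices. *)
have := eight_tight vD; move/leq_trans/(_ (max_card _)); exact: leq_trans.
Qed.
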